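(* Let $\alpha\in(0,1]$ and let $x_0$ be a regular $\alpha$ singular point of the equation $$(x-x_0)^{2\alpha}\,T_\alpha^{x_0}T_\alpha^{x_0}y+(x-x_0)^{\alpha}p(x)\,T_\alpha^{x_0}y+q(x)\,y=0, \qquad ( * )$$ where $p$ and $q$ have fractional power series expansions $$p(x)=\sum_{k=0}^{\infty}p_k(x-x_0)^{k\alpha},\qquad q(x)=\sum_{k=0}^{\infty}q_k(x-x_0)^{k\alpha}$$ for $x\in(x_0,x_0+\rho)$ with $\rho>0$. Let $s_1$ and $s_2$ be the two real roots (counted with multiplicity) of the fractional indicial equation $$\alpha^2 s(s-1)+\alpha s\,p_0+q_0=0.$$ (i) If $s_1=s_2$, then there are two linearly independent solutions of $( * )$, which have, respectively, the forms $$y_1(x)=\sum_{k=0}^{\infty}c_k(x-x_0)^{(k+s_1)\alpha}\quad(c_0\neq0),$$ $$y_2(x)=\ln|x-x_0|\;y_1(x)+\sum_{k=0}^{\infty}b_k(x-x_0)^{(k+s_1+1)\alpha}$$ for $x\in(x_0,x_0+\rho)$. (ii) If $s_1-s_2$ is a positive integer, then there are two linearly independent solutions of $( * )$, which have, respectively, the forms $$y_1(x)=\sum_{k=0}^{\infty}c_k(x-x_0)^{(k+s_1)\alpha}\quad(c_0\neq0),$$ $$y_2(x)=C\,\ln|x-x_0|\;y_1(x)+\sum_{k=0}^{\infty}b_k(x-x_0)^{(k+s_2)\alpha}$$ for $x\in(x_0,x_0+\rho)$, where $C$ is a constant (possibly zero).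
   Context: For $\alpha\in(0,1]$ and $a\in\mathbb{R}$, the (left) conformable fractional derivative of order $\alpha$ of a function $f:[a,\infty)\to\mathbb{R}$ is $$(T_\alpha^a f)(x)=\lim_{\varepsilon\to0}\frac{f(x+\varepsilon(x-a)^{1-\alpha})-f(x)}{\varepsilon},\qquad x>a$$ (the same definition is used at points $x>a$ for functions defined only on an interval with left endpoint $a$). $T_\alpha^aT_\alpha^a y$ denotes applying $T_\alpha^a$ twice. All coefficients $p_k,q_k,c_k,b_k,C$ are real. A real function $f$ is $\alpha$-analytic at $x_0$ if near $x_0$ it can be expressed as a convergent series $\sum_{k\ge0}c_k(x-x_0)^{k\alpha}$ with real $c_k$. For an equation $T_\alpha^{x_0}T_\alpha^{x_0}y+a_1(x)T_\alpha^{x_0}y+a_0(x)y=0$, the point $x_0$ is an $\alpha$-ordinary point if $a_0,a_1$ are $\alpha$-analytic at $x_0$; otherwise it is an $\alpha$ singular point. An $\alpha$ singular point $x_0$ is a regular $\alpha$ singular point if $(x-x_0)^{\alpha}a_1(x)$ and $(x-x_0)^{2\alpha}a_0(x)$ are $\alpha$-analytic at $x_0$. For equation $( * )$ one has $a_1(x)=p(x)/(x-x_0)^{\alpha}$ and $a_0(x)=q(x)/(x-x_0)^{2\alpha}$, so $x_0$ being a regular $\alpha$ singular point means that $p$ and $q$ are $\alpha$-analytic at $x_0$ (and $x_0$ is not $\alpha$-ordinary). *)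

(* Defs.v *)
From Stdlib Require Import Reals.
From Coquelicot Require Import Coquelicot.
Open Scope R_scope.

(* Real powers [t^r] are [Rpower t r = exp (r * ln t)], which is the usual power
   for [t > 0] only.  All powers below are evaluated at [t = x - x0] with
   [x > x0]. *)

Definition conf_quot (alpha a : R) (f : R -> R) (x eps : R) : R :=
  (f (x + eps * Rpower (x - a) (1 - alpha)) - f x) / eps.

Definition ex_conf (alpha a : R) (f : R -> R) (x : R) : Prop :=
  ex_finite_lim (conf_quot alpha a f x) 0.

(* Total operator [T_alpha^a]; only meaningful at points where [ex_conf] holds. *)
Definition conf (alpha a : R) (f : R -> R) (x : R) : R :=
  real (Lim (conf_quot alpha a f x) 0).

(* [f x = sum_k c_k (x - x0)^((k + s) alpha)], convergent, on (x0, x0 + rho). *)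
Definition frac_expansion (alpha x0 rho s : R) (c : nat -> R) (f : R -> R) : Prop :=
  forall x : R, x0 < x < x0 + rho ->
    is_series (fun k : nat => c k * Rpower (x - x0) ((INR k + s) * alpha)) (f x).

(* The coefficients of the equation are only defined to the right of [x0], so
   "near x0" means on a right neighbourhood of [x0] without [x0] itself. *)
Definition alpha_analytic (alpha x0 : R) (f : R -> R) : Prop :=
  exists (delta : R) (c : nat -> R),
    0 < delta /\ frac_expansion alpha x0 delta 0 c f.

(* The next two refer to [T T y + a1 T y + a0 y = 0]. *)
Definition alpha_ordinary (alpha x0 : R) (a1 a0 : R -> R) : Prop :=
  alpha_analytic alpha x0 a0 /\ alpha_analytic alpha x0 a1.

Definition regular_alpha_singular (alpha x0 : R) (a1 a0 : R -> R) : Prop :=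
  ~ alpha_ordinary alpha x0 a1 a0 /\
  alpha_analytic alpha x0 (fun x => Rpower (x - x0) alpha * a1 x) /\
  alpha_analytic alpha x0 (fun x => Rpower (x - x0) (2 * alpha) * a0 x).

Definition is_solution (alpha x0 rho : R) (p q y : R -> R) : Prop :=
  forall x : R, x0 < x < x0 + rho ->
    ex_conf alpha x0 y x /\
    ex_conf alpha x0 (conf alpha x0 y) x /\
    Rpower (x - x0) (2 * alpha) * conf alpha x0 (conf alpha x0 y) x
    + Rpower (x - x0) alpha * p x * conf alpha x0 y x
    + q x * y x = 0.

Definition indicial (alpha p0 q0 s : R) : R :=
  alpha ^ 2 * (s * (s - 1)) + alpha * s * p0 + q0.

(* [s1], [s2] are the roots, counted with multiplicity, of the quadratic
   polynomial function [g] with leading coefficient [l]. *)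
Definition quadratic_roots (l : R) (g : R -> R) (s1 s2 : R) : Prop :=
  forall s : R, g s = l * ((s - s1) * (s - s2)).

Definition lin_indep_on (a b : R) (f g : R -> R) : Prop :=
  forall A B : R,
    (forall x : R, a < x < b -> A * f x + B * g x = 0) -> A = 0 /\ B = 0.

(* Main.v *)
Require Import Defs.
From Stdlib Require Import Reals Lra Lia Arith.
From Coquelicot Require Import Coquelicot.
Open Scope R_scope.

(** Put [t = (x - x0) ^ alpha]. The conformable derivative of a function of [t] is
    [alpha] times its ordinary derivative in [t], so with [theta = t * d/dt] the equation
    is the classical Fuchsian one [L y = 0],
    [L = alpha ^ 2 * (theta ^ 2 - theta) + alpha * p * theta + q], with [p] and [q] power
    series in [t] converging for [0 < t < rho ^ alpha], and Frobenius' method applies.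

    On a series [t ^ s * sum u_k t ^ k] the operator [L] acts on coefficients
    ([ode_coef]): the coefficient of index [k] is [indicial (s + k) * u_k] plus a
    combination of the earlier [u_j]. So [L u = g] can be solved recursively wherever
    the indicial polynomial does not vanish ([ode_coef_solvable]). The indicial
    polynomial grows like [k ^ 2] while the combination carries only one factor [j + 1],
    so no solution of the recursion grows faster than its data, and the series converges
    on the whole interval ([subexponential_growth], [ode_coef_radius]).

    Write [s1 = s2 + N]. No [s1 + k] with [k > 0] is a root, which gives [y1] with
    [c_0 = 1]. Since [theta] is a derivation, [L (ln (x - x0) * y1)] is a series with
    exponent [s1] and no logarithm; subtracting a suitable series with exponent [s1]
    gives [z] with [L z = alpha * N * c_0 * t ^ s1] ([frobenius_log]).

    If [N = 0], then [z] is the second solution. If [N > 0], start the recursion at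
    [s2] with [u_0 = 1] and ignore its failure at index [N]: the resulting series
    satisfies [L phi = d * t ^ s1] for some [d] ([frobenius_smaller_root]), and the
    second solution is the combination of [phi] and [z] in which the two multiples of
    [t ^ s1] cancel; the multiple of [z] taken is the constant [C].

    Independence is read off the behaviour at [t = 0]: compared with [y1], the second
    solution is dominated by [ln t] if [N = 0], and by [t ^ (- N)] if [N > 0]
    ([lin_indep_log]). *)

(** * Coefficient sequences *)

Definition euler_coef (s : R) (u : nat -> R) (k : nat) : R := (s + INR k) * u k.

(** Coefficients of the left-hand side of the equation, divided by
    [(x - x0) ^ (s * alpha)], at the series with exponent [s] and coefficients [u]. *)
Definition ode_coef (alpha : R) (pc qc : nat -> R) (s : R) (u : nat -> R) (k : nat) : R :=
  alpha ^ 2 * (euler_coef s (euler_coef s u) k - euler_coef s u k)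
  + alpha * PS_mult (euler_coef s u) pc k + PS_mult u qc k.

Definition ode_tail (alpha : R) (pc qc : nat -> R) (s : R) (m : nat) (u : nat -> R) : R :=
  sum_f_R0 (fun j => (alpha * (s + INR j) * pc (S m - j)%nat + qc (S m - j)%nat) * u j) m.

Lemma ode_coef_0 (alpha : R) (pc qc : nat -> R) (s : R) (u : nat -> R) :
  ode_coef alpha pc qc s u 0 = indicial alpha (pc 0%nat) (qc 0%nat) s * u 0%nat.
Proof.
  unfold ode_coef, euler_coef, indicial, PS_mult; simpl; ring.
Qed.

Lemma ode_coef_S (alpha : R) (pc qc : nat -> R) (s : R) (u : nat -> R) (m : nat) :
  ode_coef alpha pc qc s u (S m) =
  indicial alpha (pc 0%nat) (qc 0%nat) (s + INR (S m)) * u (S m)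
  + ode_tail alpha pc qc s m u.
Proof.
  unfold ode_coef, PS_mult, ode_tail.
  rewrite !tech5, Nat.sub_diag.
  rewrite (sum_eq (fun j => (alpha * (s + INR j) * pc (S m - j)%nat + qc (S m - j)%nat) * u j)
    (fun j => (euler_coef s u j * pc (S m - j)%nat) * alpha + u j * qc (S m - j)%nat)).
  2: { intros i _. unfold euler_coef. ring. }
  rewrite sum_plus, <- scal_sum.
  unfold euler_coef, indicial. ring.
Qed.

Lemma course_of_values (u0 : R) (F : nat -> (nat -> R) -> R) :
  (forall m u v, (forall j, (j <= m)%nat -> u j = v j) -> F m u = F m v) ->
  exists u : nat -> R, u 0%nat = u0 /\ forall m, u (S m) = F m u.
Proof.
  intros HF.
  pose (w := fix w (n : nat) : nat -> R :=
    match n with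
    | O => fun _ => u0
    | S n' => fun k => if Nat.eqb k (S n') then F n' (w n') else w n' k
    end).
  (* [w n] is final on the indices up to [n], so its diagonal is the solution *)
  assert (stable : forall n j, (j <= n)%nat -> w n j = w j j).
  { induction n as [|n IH]; intros j Hj.
    - replace j with 0%nat by lia. reflexivity.
    - destruct (Nat.eq_dec j (S n)) as [->|Hne]; [reflexivity|].
      simpl. rewrite (proj2 (Nat.eqb_neq _ _) Hne). apply IH. lia. }
  exists (fun k => w k k). split; [reflexivity|].
  intros m. simpl. rewrite Nat.eqb_refl.
  apply HF. intros j Hj. now apply stable.
Qed.

Lemma ode_coef_solvable (alpha : R) (pc qc : nat -> R) (s u0 : R) (g : nat -> R) :
  exists u : nat -> R, u 0%nat = u0 /\
    forall m, indicial alpha (pc 0%nat) (qc 0%nat) (s + INR (S m)) <> 0 ->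
      ode_coef alpha pc qc s u (S m) = g (S m).
Proof.
  destruct (course_of_values u0 (fun m u =>
    (g (S m) - ode_tail alpha pc qc s m u)
    / indicial alpha (pc 0%nat) (qc 0%nat) (s + INR (S m)))) as [u [H0 HS]].
  { intros m u v Huv. unfold ode_tail. f_equal. f_equal.
    apply sum_eq. intros j Hj. now rewrite Huv. }
  exists u. split; [exact H0|].
  intros m Hm. rewrite ode_coef_S, HS. now field.
Qed.

(** * Convergence of the recursively defined series *)

Lemma geometric_sum_le (lambda : R) (m : nat) :
  1 < lambda -> (lambda - 1) * sum_f_R0 (fun j => lambda ^ j) m <= lambda ^ (S m).
Proof.
  intros Hl. rewrite tech3 by lra.
  replace ((lambda - 1) * ((1 - lambda ^ S m) / (1 - lambda)))
    with (lambda ^ S m - 1) by (field; lra).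
  lra.
Qed.

Lemma finite_bound (v : nat -> R) (K : nat) :
  exists B, 1 <= B /\ forall k, (k <= K)%nat -> v k <= B.
Proof.
  induction K as [|K [B [HB HK]]].
  - exists (Rmax 1 (v 0%nat)). split; [apply Rmax_l|].
    intros k Hk. replace k with 0%nat by lia. apply Rmax_r.
  - exists (Rmax B (v (S K))). split.
    + apply Rle_trans with B; [assumption|apply Rmax_l].
    + intros k Hk. destruct (Nat.eq_dec k (S K)) as [->|Hne].
      * apply Rmax_r.
      * apply Rle_trans with B; [apply HK; lia|apply Rmax_l].
Qed.

(** If [v j <= B * lambda ^ j] for [j <= m] then the sum is at most
    [(m + 1) * B * lambda ^ (m + 1) / (lambda - 1)]: it gains one factor [m + 1],
    and the left-hand side has two, so the bound passes to [m + 1] once [m] is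
    large. *)
Lemma subexponential_growth (delta M lambda : R) (K : nat) (v : nat -> R) :
  0 < delta -> 0 <= M -> 1 < lambda ->
  (forall m, (K <= m)%nat ->
     delta * INR (S m) ^ 2 * v (S m)
     <= M * (1 + sum_f_R0 (fun j => INR (S j) * v j) m)) ->
  exists B, forall k, v k <= B * lambda ^ k.
Proof.
  intros Hd HM Hl Hrec.
  destruct (INR_unbounded ((M + M / (lambda - 1)) / delta)) as [K' HK'].
  destruct (finite_bound v (Nat.max K K')) as [B [HB1 HB]].
  exists B.
  intros k. induction k as [k IH] using (well_founded_induction lt_wf).
  assert (Hpow : forall n, 1 <= lambda ^ n) by (intros n; apply pow_R1_Rle; lra).
  destruct (le_lt_dec k (Nat.max K K')) as [Hk|Hk].
  - apply Rle_trans with B; [now apply HB|]. specialize (Hpow k). nra.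
  - destruct k as [|m]; [lia|].
    assert (Hsum : sum_f_R0 (fun j => INR (S j) * v j) m
                   <= INR (S m) * (B * (lambda ^ S m / (lambda - 1)))).
    { apply Rle_trans with (sum_f_R0 (fun j => lambda ^ j * (INR (S m) * B)) m).
      - apply sum_Rle. intros j Hj.
        assert (INR (S j) <= INR (S m)) by (apply le_INR; lia).
        assert (0 < INR (S j)) by (apply lt_0_INR; lia).
        assert (Hv := IH j ltac:(lia)).
        assert (Hp := Hpow j).
        apply Rle_trans with (INR (S j) * (B * lambda ^ j)); [nra|].
        replace (lambda ^ j * (INR (S m) * B)) with (INR (S m) * (B * lambda ^ j)) by ring.
        apply Rmult_le_compat_r; nra.
      - rewrite <- scal_sum, Rmult_assoc.
        apply Rmult_le_compat_l; [apply pos_INR|].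
        apply Rmult_le_compat_l; [lra|].
        apply Rle_div_r; [lra|]. rewrite Rmult_comm. now apply geometric_sum_le. }
    assert (Hm := Hrec m ltac:(lia)).
    set (n := INR (S m)) in *.
    assert (Hn1 : 1 <= n) by (unfold n; rewrite S_INR; assert (h := pos_INR m); lra).
    assert (Hn : (M + M / (lambda - 1)) <= delta * n).
    { assert (INR K' <= n) by (apply le_INR; lia).
      rewrite (Rmult_comm delta). apply Rle_div_l; lra. }
    assert (Hp := Hpow (S m)). set (L := lambda ^ S m) in *.
    assert (HBL : 1 <= B * L) by nra.
    assert (Hmain : delta * n ^ 2 * v (S m) <= delta * n ^ 2 * (B * L)).
    { apply Rle_trans with (M * (1 + n * (B * (L / (lambda - 1))))).
      - apply Rle_trans with (1 := Hm). apply Rmult_le_compat_l; lra.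
      - apply Rle_trans with ((M + M / (lambda - 1)) * (n * (B * L))).
        + replace ((M + M / (lambda - 1)) * (n * (B * L)))
            with (M * (n * (B * L) + n * (B * (L / (lambda - 1))))) by (field; lra).
          apply Rmult_le_compat_l; [lra|]. nra.
        + replace (delta * n ^ 2 * (B * L)) with ((delta * n) * (n * (B * L))) by ring.
          apply Rmult_le_compat_r; nra. }
    refine (Rmult_le_reg_l _ _ _ _ Hmain).
    apply Rmult_lt_0_compat; [lra|apply pow_lt; lra].
Qed.

Definition radius_ge (r : R) (u : nat -> R) : Prop := Rbar_le r (CV_radius u).

Lemma radius_ge_of_bound (r : R) (u : nat -> R) :
  (forall t, 0 < t < r -> exists M, forall n, Rabs (u n * t ^ n) <= M) ->
  radius_ge r u.
Proof.
  intros H. unfold radius_ge.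
  destruct (CV_radius_bounded u) as [ub _].
  assert (h0 := CV_radius_ge_0 u).
  destruct (CV_radius u) as [c| |] eqn:E; simpl in *; try easy.
  apply Rnot_lt_le. intros Hc.
  assert (Ht := H ((c + r) / 2) ltac:(lra)).
  apply ub in Ht. simpl in Ht. lra.
Qed.

Lemma radius_ge_ex_pseries (r : R) (u : nat -> R) :
  (forall t, 0 < t < r -> ex_pseries u t) -> radius_ge r u.
Proof.
  intros H. unfold radius_ge.
  assert (h0 := CV_radius_ge_0 u).
  destruct (CV_radius u) as [c| |] eqn:E; simpl in *; try easy.
  apply Rnot_lt_le. intros Hc.
  assert (Ht := H ((c + r) / 2) ltac:(lra)).
  apply (CV_disk_outside u ((c + r) / 2)).
  - rewrite E, Rabs_pos_eq by lra. simpl. lra.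
  - apply ex_series_lim_0. revert Ht. unfold ex_pseries. apply ex_series_ext.
    intros n. rewrite pow_n_pow. unfold scal; simpl; unfold mult; simpl. ring.
Qed.

Lemma radius_ge_lt (r : R) (u : nat -> R) (t : R) :
  radius_ge r u -> 0 <= t < r -> Rbar_lt (Rabs t) (CV_radius u).
Proof.
  intros H Ht. apply Rbar_lt_le_trans with r; [|exact H].
  rewrite Rabs_pos_eq; simpl; lra.
Qed.

Lemma radius_ge_bound (r : R) (u : nat -> R) (t : R) :
  radius_ge r u -> 0 < t < r -> exists M, 0 <= M /\ forall n, Rabs (u n) * t ^ n <= M.
Proof.
  intros H Ht.
  assert (Hs := CV_disk_inside u t (radius_ge_lt r u t H ltac:(lra))).
  apply ex_series_lim_0 in Hs.
  destruct (filterlim_bounded _ (ex_intro _ 0 Hs)) as [M HM].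
  exists (Rabs M). split; [apply Rabs_pos|].
  intros n. specialize (HM n).
  change (Rabs (Rabs (u n * t ^ n)) <= M) in HM.
  rewrite Rabs_Rabsolu, Rabs_mult, (Rabs_pos_eq (t ^ n)) in HM by (apply pow_le; lra).
  apply Rle_trans with (1 := HM). apply Rle_abs.
Qed.

Lemma radius_ge_ext (r : R) (u v : nat -> R) :
  (forall n, u n = v n) -> radius_ge r u -> radius_ge r v.
Proof. intros E. unfold radius_ge. now rewrite (CV_radius_ext u v E). Qed.

Lemma radius_ge_zero (r : R) : radius_ge r (fun _ => 0).
Proof. unfold radius_ge. now rewrite CV_radius_const_0. Qed.

Lemma radius_ge_plus (r : R) (u v : nat -> R) :
  radius_ge r u -> radius_ge r v -> radius_ge r (PS_plus u v).
Proof.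
  intros Hu Hv. unfold radius_ge in *.
  apply Rbar_le_trans with (2 := CV_radius_plus u v).
  now apply Rbar_min_case.
Qed.

Lemma radius_ge_scal (r c : R) (u : nat -> R) :
  radius_ge r u -> radius_ge r (PS_scal c u).
Proof.
  intros Hu. destruct (Req_dec c 0) as [->|Hc].
  - apply radius_ge_ext with (2 := radius_ge_zero r).
    intros n. unfold PS_scal, scal; simpl; unfold mult; simpl. ring.
  - unfold radius_ge. now rewrite CV_radius_scal.
Qed.

Lemma radius_ge_mult (r : R) (u v : nat -> R) :
  radius_ge r u -> radius_ge r v -> radius_ge r (PS_mult u v).
Proof.
  intros Hu Hv. apply radius_ge_ex_pseries. intros t Ht.
  apply ex_pseries_mult; apply radius_ge_lt with r; trivial; lra.
Qed.

Lemma euler_coef_split (s : R) (u : nat -> R) (k : nat) :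
  PS_plus (PS_scal s u) (PS_incr_1 (PS_derive u)) k = euler_coef s u k.
Proof.
  destruct k as [|k].
  - change (s * u 0%nat + 0 = (s + 0) * u 0%nat). ring.
  - change (s * u (S k) + INR (S k) * u (S k) = (s + INR (S k)) * u (S k)). ring.
Qed.

Lemma radius_ge_euler (r s : R) (u : nat -> R) :
  radius_ge r u -> radius_ge r (euler_coef s u).
Proof.
  intros Hu. apply radius_ge_ext with (1 := euler_coef_split s u).
  apply radius_ge_plus; [now apply radius_ge_scal|].
  unfold radius_ge. now rewrite CV_radius_incr_1, CV_radius_derive.
Qed.

Lemma radius_ge_incr_n (r : R) (N : nat) (u : nat -> R) :
  radius_ge r u -> radius_ge r (PS_incr_n u N).
Proof.
  intros Hu. induction N as [|N IH]; simpl; trivial.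
  unfold radius_ge. now rewrite CV_radius_incr_1.
Qed.

(** The leading term [alpha ^ 2 * k ^ 2] of the indicial polynomial at [s + k]
    dominates eventually, for every [s]. *)
Lemma indicial_ge (alpha p0 q0 s : R) :
  0 < alpha ->
  exists K, forall k, (K <= k)%nat ->
    alpha ^ 2 / 2 * INR k ^ 2 <= Rabs (indicial alpha p0 q0 (s + INR k)).
Proof.
  intros Ha.
  set (b := alpha ^ 2 * (2 * s - 1) + alpha * p0).
  set (c := indicial alpha p0 q0 s).
  destruct (INR_unbounded (1 + (Rabs b + Rabs c) / (alpha ^ 2 / 2))) as [K HK].
  exists K. intros k Hk.
  apply Rle_trans with (2 := Rle_abs _).
  replace (indicial alpha p0 q0 (s + INR k))
    with (alpha ^ 2 * INR k ^ 2 + b * INR k + c) by (unfold b, c, indicial; ring).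
  assert (Hkk := le_INR _ _ Hk).
  assert (Ha2 : 0 < alpha ^ 2 / 2) by nra.
  assert (Hbc : (Rabs b + Rabs c) <= INR k * (alpha ^ 2 / 2)).
  { apply Rle_div_l; lra. }
  assert (0 <= (Rabs b + Rabs c) / (alpha ^ 2 / 2)).
  { apply Rdiv_le_0_compat; [|lra]. assert (h1 := Rabs_pos b). assert (h2 := Rabs_pos c). lra. }
  assert (Hk1 : 1 <= INR k) by lra.
  assert (hb := Rabs_maj2 b). assert (hc := Rabs_maj2 c).
  assert (h1 := Rabs_pos c).
  assert ((Rabs b + Rabs c) * INR k <= INR k * (alpha ^ 2 / 2) * INR k)
    by (apply Rmult_le_compat_r; lra).
  nra.
Qed.

(** With [v k = |u k| * r ^ k], the coefficient bounds [M / r ^ k] make the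
    recursion exactly the inequality of [subexponential_growth], so the series
    converges up to every [t < r]. *)
Lemma ode_coef_radius (alpha rad s : R) (pc qc g u : nat -> R) (K : nat) :
  0 < alpha ->
  radius_ge rad pc -> radius_ge rad qc -> radius_ge rad g ->
  (forall k, (K <= k)%nat -> ode_coef alpha pc qc s u k = g k) ->
  radius_ge rad u.
Proof.
  intros Ha Hp Hq Hg Hu. apply radius_ge_of_bound. intros t Ht.
  set (r := (t + rad) / 2).
  assert (Hr : t < r < rad) by (unfold r; lra).
  destruct (radius_ge_bound rad pc r Hp ltac:(lra)) as [Mp [Mp0 HMp]].
  destruct (radius_ge_bound rad qc r Hq ltac:(lra)) as [Mq [Mq0 HMq]].
  destruct (radius_ge_bound rad g r Hg ltac:(lra)) as [Mg [Mg0 HMg]].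
  destruct (indicial_ge alpha (pc 0%nat) (qc 0%nat) s Ha) as [K' HK'].
  set (sigma := alpha * (Rabs s + 1)).
  assert (Hsigma : 0 < sigma) by (unfold sigma; assert (h := Rabs_pos s); nra).
  destruct (subexponential_growth (alpha ^ 2 / 2) (Mg + (sigma * Mp + Mq)) (r / t)
    (Nat.max K K') (fun k => Rabs (u k) * r ^ k)) as [B HB].
  - nra.
  - nra.
  - apply Rlt_div_r; lra.
  - intros m Hm.
    assert (Hrp : forall n, 0 < r ^ n) by (intros n; apply pow_lt; lra).
    set (I := indicial alpha (pc 0%nat) (qc 0%nat) (s + INR (S m))).
    assert (HI := HK' (S m) ltac:(lia)). fold I in HI.
    assert (Hrec := Hu (S m) ltac:(lia)). rewrite ode_coef_S in Hrec. fold I in Hrec.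
    assert (HIu : Rabs I * Rabs (u (S m)) <= Rabs (g (S m)) + Rabs (ode_tail alpha pc qc s m u)).
    { rewrite <- Rabs_mult.
      replace (I * u (S m)) with (g (S m) + - ode_tail alpha pc qc s m u) by lra.
      apply Rle_trans with (1 := Rabs_triang _ _). rewrite Rabs_Ropp. lra. }
    assert (Htail : Rabs (ode_tail alpha pc qc s m u) * r ^ S m
      <= (sigma * Mp + Mq) * sum_f_R0 (fun j => INR (S j) * (Rabs (u j) * r ^ j)) m).
    { unfold ode_tail.
      apply Rle_trans with (r ^ S m * sum_f_R0 (fun j => Rabs ((alpha * (s + INR j) * pc (S m - j)%nat
          + qc (S m - j)%nat) * u j)) m).
      { rewrite Rmult_comm. apply Rmult_le_compat_l; [left; apply Hrp|].
        apply Rsum_abs. }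
      rewrite !scal_sum. apply sum_Rle. intros j Hj.
      rewrite Rabs_mult.
      replace (r ^ S m) with (r ^ (S m - j) * r ^ j) by (rewrite <- pow_add; f_equal; lia).
      set (i := (S m - j)%nat).
      assert (Hc : Rabs (alpha * (s + INR j) * pc i + qc i) * r ^ i
                   <= INR (S j) * (sigma * Mp + Mq)).
      { assert (h1 := HMp i). assert (h2 := HMq i). assert (h3 := Hrp i).
        assert (h4 := pos_INR j).
        assert (Hsj : Rabs (alpha * (s + INR j)) <= INR (S j) * sigma).
        { rewrite Rabs_mult, (Rabs_pos_eq alpha) by lra.
          assert (h5 := Rabs_triang s (INR j)). rewrite (Rabs_pos_eq (INR j)) in h5 by lra.
          rewrite S_INR. unfold sigma.
          replace ((INR j + 1) * (alpha * (Rabs s + 1)))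
            with (alpha * ((INR j + 1) * (Rabs s + 1))) by ring.
          apply Rmult_le_compat_l; [lra|]. assert (h6 := Rabs_pos s). nra. }
        apply Rle_trans with ((Rabs (alpha * (s + INR j)) * Rabs (pc i) + Rabs (qc i)) * r ^ i).
        { apply Rmult_le_compat_r; [lra|].
          rewrite <- Rabs_mult. apply Rabs_triang. }
        rewrite Rmult_plus_distr_r, Rmult_assoc.
        apply Rle_trans with (INR (S j) * sigma * Mp + Mq).
        { apply Rplus_le_compat; [|exact h2].
          apply Rmult_le_compat; trivial; try apply Rabs_pos.
          apply Rmult_le_pos; [apply Rabs_pos|lra]. }
        rewrite S_INR. nra. }
      replace (Rabs (alpha * (s + INR j) * pc i + qc i) * Rabs (u j) * (r ^ i * r ^ j))
        with (Rabs (alpha * (s + INR j) * pc i + qc i) * r ^ i * (Rabs (u j) * r ^ j)) by ring.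
      replace (INR (S j) * (Rabs (u j) * r ^ j) * (sigma * Mp + Mq))
        with (INR (S j) * (sigma * Mp + Mq) * (Rabs (u j) * r ^ j)) by ring.
      apply Rmult_le_compat_r; [|exact Hc].
      apply Rmult_le_pos; [apply Rabs_pos|left; apply Hrp]. }
    set (T := sum_f_R0 (fun j => INR (S j) * (Rabs (u j) * r ^ j)) m) in *.
    assert (HT : 0 <= T).
    { apply cond_pos_sum. intros j. apply Rmult_le_pos; [apply pos_INR|].
      apply Rmult_le_pos; [apply Rabs_pos|left; apply Hrp]. }
    assert (hg := HMg (S m)). assert (hr := Hrp (S m)).
    apply Rle_trans with (Rabs I * Rabs (u (S m)) * r ^ S m).
    { rewrite <- Rmult_assoc. apply Rmult_le_compat_r; [lra|].
      apply Rmult_le_compat_r; [apply Rabs_pos|exact HI]. }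
    apply Rle_trans with ((Rabs (g (S m)) + Rabs (ode_tail alpha pc qc s m u)) * r ^ S m).
    { apply Rmult_le_compat_r; lra. }
    nra.
  - exists B. intros n. specialize (HB n). simpl in HB.
    rewrite Rabs_mult, (Rabs_pos_eq (t ^ n)) by (apply pow_le; lra).
    assert (Htn : 0 < t ^ n) by (apply pow_lt; lra).
    assert (Hrn : 0 < r ^ n) by (apply pow_lt; lra).
    apply Rmult_le_reg_r with (r ^ n / t ^ n); [now apply Rdiv_lt_0_compat|].
    unfold Rdiv in HB. rewrite Rpow_mult_distr, pow_inv in HB.
    replace (Rabs (u n) * t ^ n * (r ^ n / t ^ n)) with (Rabs (u n) * r ^ n) by (field; lra).
    exact HB.
Qed.

(** * Conformable derivatives and the Euler operator *)

Lemma is_derive_conf_quot (alpha a : R) (f : R -> R) (x l : R) :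
  is_derive f x l ->
  is_lim (conf_quot alpha a f x) 0 (Rpower (x - a) (1 - alpha) * l).
Proof.
  intros Hf. set (w := Rpower (x - a) (1 - alpha)).
  assert (Hg : is_derive (fun eps => f (x + eps * w)) 0 (w * l)).
  { apply (is_derive_comp f (fun eps => x + eps * w)).
    - now rewrite Rmult_0_l, Rplus_0_r.
    - auto_derive; trivial; ring. }
  apply is_derive_Reals in Hg.
  apply is_lim_spec. intros eps.
  destruct (Hg eps (cond_pos eps)) as [d Hd].
  exists d. intros h Hh Hh0.
  specialize (Hd h Hh0).
  rewrite Rplus_0_l, Rmult_0_l, Rplus_0_r in Hd.
  apply Hd.
  change (Rabs (h - 0) < d) in Hh. now rewrite Rminus_0_r in Hh.
Qed.

Lemma is_derive_ex_conf (alpha a : R) (f : R -> R) (x l : R) :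
  is_derive f x l -> ex_conf alpha a f x.
Proof.
  intros Hf. exists (Rpower (x - a) (1 - alpha) * l). now apply is_derive_conf_quot.
Qed.

Lemma is_derive_conf (alpha a : R) (f : R -> R) (x l : R) :
  is_derive f x l -> conf alpha a f x = Rpower (x - a) (1 - alpha) * l.
Proof.
  intros Hf. unfold conf.
  now rewrite (is_lim_unique _ _ _ (is_derive_conf_quot alpha a f x l Hf)).
Qed.

(** In the variable [t = (x - x0) ^ alpha], [g] is [t * df/dt]: the Euler operator
    maps a series with exponent [s] to a series with the same exponent, and turns
    the equation into one whose coefficients are the power series [p] and [q]. *)
Definition euler_derive (alpha x0 rho : R) (f g : R -> R) : Prop :=
  forall x, x0 < x < x0 + rho -> is_derive f x (alpha * g x / (x - x0)).

Lemma euler_derive_plus (alpha x0 rho : R) (f1 f2 g1 g2 : R -> R) :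
  euler_derive alpha x0 rho f1 g1 -> euler_derive alpha x0 rho f2 g2 ->
  euler_derive alpha x0 rho (fun x => f1 x + f2 x) (fun x => g1 x + g2 x).
Proof.
  intros H1 H2 x Hx.
  replace (alpha * (g1 x + g2 x) / (x - x0))
    with (alpha * g1 x / (x - x0) + alpha * g2 x / (x - x0)) by (field; lra).
  apply (is_derive_plus f1 f2); auto.
Qed.

Lemma euler_derive_scal (alpha x0 rho k : R) (f g : R -> R) :
  euler_derive alpha x0 rho f g ->
  euler_derive alpha x0 rho (fun x => k * f x) (fun x => k * g x).
Proof.
  intros H x Hx.
  replace (alpha * (k * g x) / (x - x0))
    with (k * (alpha * g x / (x - x0))) by (field; lra).
  apply (is_derive_scal f). auto.
Qed.

Lemma is_derive_Rpower_shift (x0 r x : R) :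
  x0 < x ->
  is_derive (fun y => Rpower (y - x0) r) x (r * / (x - x0) * Rpower (x - x0) r).
Proof.
  intros Hx. unfold Rpower. auto_derive; [lra|].
  replace (x + - x0) with (x - x0) by ring.
  set (e := exp (r * ln (x - x0))). field. lra.
Qed.

Lemma euler_derive_ln_mult (alpha x0 rho : R) (f g : R -> R) :
  0 < alpha ->
  euler_derive alpha x0 rho f g ->
  euler_derive alpha x0 rho (fun x => ln (x - x0) * f x)
    (fun x => / alpha * f x + ln (x - x0) * g x).
Proof.
  intros Ha H x Hx.
  replace (alpha * (/ alpha * f x + ln (x - x0) * g x) / (x - x0))
    with (/ (x - x0) * f x + ln (x - x0) * (alpha * g x / (x - x0))) by (field; lra).
  apply (is_derive_mult (fun y => ln (y - x0)) f).
  - auto_derive; [lra|]. field. lra.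
  - auto.
  - intros n m. apply Rmult_comm.
Qed.

(** [f] solves the equation with right-hand side [r], the derivatives being
    expressed through the Euler operator. *)
Definition euler_equation (alpha x0 rho : R) (p q f r : R -> R) : Prop :=
  exists g g2 : R -> R,
    euler_derive alpha x0 rho f g /\ euler_derive alpha x0 rho g g2 /\
    forall x, x0 < x < x0 + rho ->
      alpha ^ 2 * (g2 x - g x) + alpha * p x * g x + q x * f x = r x.

Lemma euler_equation_ext_rhs (alpha x0 rho : R) (p q f r r' : R -> R) :
  (forall x, x0 < x < x0 + rho -> r x = r' x) ->
  euler_equation alpha x0 rho p q f r -> euler_equation alpha x0 rho p q f r'.
Proof.
  intros E (g & g2 & Hg & Hg2 & H). exists g, g2. split; [|split]; trivial.
  intros x Hx. rewrite <- E by trivial. auto.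
Qed.

Lemma euler_equation_lin (alpha x0 rho k : R) (p q f1 r1 f2 r2 : R -> R) :
  euler_equation alpha x0 rho p q f1 r1 -> euler_equation alpha x0 rho p q f2 r2 ->
  euler_equation alpha x0 rho p q (fun x => f1 x + k * f2 x) (fun x => r1 x + k * r2 x).
Proof.
  intros (g & g2 & Hg & Hg2 & H) (h & h2 & Hh & Hh2 & H').
  exists (fun x => g x + k * h x), (fun x => g2 x + k * h2 x). split; [|split].
  - apply euler_derive_plus; trivial. now apply euler_derive_scal.
  - apply euler_derive_plus; trivial. now apply euler_derive_scal.
  - intros x Hx. rewrite <- H, <- H' by trivial. ring.
Qed.

Lemma locally_open_interval (a b x : R) : a < x < b -> locally x (fun y => a < y < b).
Proof.
  intros Hx.
  apply (locally_interval _ x (Finite a) (Finite b)); simpl; try lra; trivial.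
  intros y H1 H2. simpl in *. lra.
Qed.

Lemma euler_equation_is_solution (alpha x0 rho : R) (p q f : R -> R) :
  euler_equation alpha x0 rho p q f (fun _ => 0) -> is_solution alpha x0 rho p q f.
Proof.
  intros (g & g2 & Hg & Hg2 & H).
  assert (Hconf : forall x, x0 < x < x0 + rho ->
    conf alpha x0 f x = alpha * (Rpower (x - x0) (- alpha) * g x)).
  { intros x Hx. rewrite (is_derive_conf _ _ _ _ _ (Hg x Hx)).
    replace (1 - alpha) with (1 + - alpha) by ring.
    rewrite Rpower_plus, Rpower_1 by lra. field. lra. }
  assert (Hder : forall x, x0 < x < x0 + rho ->
    is_derive (conf alpha x0 f) x
      (alpha ^ 2 * (Rpower (x - x0) (- alpha) * (g2 x - g x) / (x - x0)))).
  { intros x Hx.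
    apply is_derive_ext_loc with (fun x => alpha * (Rpower (x - x0) (- alpha) * g x)).
    - generalize (locally_open_interval _ _ _ Hx). apply filter_imp.
      intros y Hy. symmetry. now apply Hconf.
    - replace (alpha ^ 2 * (Rpower (x - x0) (- alpha) * (g2 x - g x) / (x - x0)))
        with (alpha * (- alpha * / (x - x0) * Rpower (x - x0) (- alpha) * g x
          + Rpower (x - x0) (- alpha) * (alpha * g2 x / (x - x0)))) by (field; lra).
      apply (is_derive_scal (fun x => Rpower (x - x0) (- alpha) * g x)).
      apply (is_derive_mult (fun x => Rpower (x - x0) (- alpha)) g).
      + apply is_derive_Rpower_shift. lra.
      + auto.
      + intros n m. apply Rmult_comm. }
  intros x Hx. split; [|split].
  - eapply is_derive_ex_conf. now apply Hg.
  - eapply is_derive_ex_conf. now apply Hder.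
  - rewrite (is_derive_conf _ _ _ _ _ (Hder x Hx)), Hconf by trivial.
    replace (2 * alpha) with (alpha + alpha) by ring.
    replace (1 - alpha) with (1 + - alpha) by ring.
    rewrite !Rpower_plus, Rpower_1, Rpower_Ropp by lra.
    set (t := Rpower (x - x0) alpha).
    assert (0 < t) by apply exp_pos.
    assert (H1 := H x Hx). simpl in H1. rewrite <- H1 at 1. field. lra.
Qed.

(** * Fractional power series *)

Lemma pseries_term (t c : R) (n : nat) : scal (pow_n t n) c = c * t ^ n.
Proof. rewrite pow_n_pow. apply Rmult_comm. Qed.

Definition frob (alpha x0 s : R) (u : nat -> R) (x : R) : R :=
  Rpower (x - x0) (s * alpha) * PSeries u (Rpower (x - x0) alpha).

Lemma Rpower_nonneg_lt (alpha y rho : R) :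
  0 < alpha -> 0 < y < rho -> 0 <= Rpower y alpha < Rpower rho alpha.
Proof.
  intros Ha Hy. split; [left; apply exp_pos|]. apply Rlt_Rpower_l; lra.
Qed.

Lemma Rpower_INR_mult (alpha y s : R) (k : nat) :
  Rpower y ((INR k + s) * alpha) = Rpower y (s * alpha) * Rpower y alpha ^ k.
Proof.
  rewrite <- Rpower_pow by apply exp_pos.
  rewrite Rpower_mult, <- Rpower_plus. f_equal. ring.
Qed.

Lemma frob_expansion (alpha x0 rho s : R) (u : nat -> R) :
  0 < alpha -> radius_ge (Rpower rho alpha) u ->
  frac_expansion alpha x0 rho s u (frob alpha x0 s u).
Proof.
  intros Ha Hu x Hx.
  assert (Ht := Rpower_nonneg_lt alpha (x - x0) rho Ha ltac:(lra)).
  assert (Hs := PSeries_correct _ _ (CV_radius_inside _ _ (radius_ge_lt _ _ _ Hu Ht))).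
  apply (is_series_scal (Rpower (x - x0) (s * alpha))) in Hs.
  revert Hs. apply is_series_ext. intros n.
  rewrite Rpower_INR_mult, pseries_term. unfold scal; simpl; unfold mult; simpl. ring.
Qed.

Lemma frac_expansion_radius (alpha x0 rho : R) (pc : nat -> R) (p : R -> R) :
  0 < alpha -> 0 < rho -> frac_expansion alpha x0 rho 0 pc p ->
  radius_ge (Rpower rho alpha) pc.
Proof.
  intros Ha Hrho H. apply radius_ge_ex_pseries. intros t Ht.
  set (y := Rpower t (/ alpha)).
  assert (Hy : 0 < y < rho).
  { split; [apply exp_pos|].
    replace rho with (Rpower (Rpower rho alpha) (/ alpha)).
    - apply Rlt_Rpower_l; [now apply Rinv_0_lt_compat|lra].
    - rewrite Rpower_mult, Rinv_r, Rpower_1; lra. }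
  assert (Hyt : Rpower y alpha = t).
  { unfold y. rewrite Rpower_mult, Rinv_l, Rpower_1; lra. }
  exists (p (x0 + y)).
  generalize (H (x0 + y) ltac:(lra)). apply is_series_ext. intros n.
  rewrite Rpower_INR_mult. replace (x0 + y - x0) with y by ring.
  rewrite Rmult_0_l, Rpower_O, Hyt, pseries_term, Rmult_1_l by lra. reflexivity.
Qed.

Lemma frac_expansion_eq (alpha x0 rho : R) (pc : nat -> R) (p : R -> R) (x : R) :
  frac_expansion alpha x0 rho 0 pc p -> x0 < x < x0 + rho ->
  p x = PSeries pc (Rpower (x - x0) alpha).
Proof.
  intros H Hx. symmetry. apply is_pseries_unique.
  generalize (H x Hx). apply is_series_ext. intros n.
  rewrite Rpower_INR_mult, Rmult_0_l, Rpower_O, pseries_term, Rmult_1_l by lra. reflexivity.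
Qed.

Lemma PSeries_euler_coef (s t : R) (u : nat -> R) :
  Rbar_lt (Rabs t) (CV_radius u) ->
  PSeries (euler_coef s u) t = s * PSeries u t + t * PSeries (PS_derive u) t.
Proof.
  intros Ht. rewrite <- (PSeries_ext _ _ _ (euler_coef_split s u)).
  rewrite PSeries_plus, PSeries_scal, PSeries_incr_1; trivial.
  - apply ex_pseries_scal; [apply Rmult_comm|]. now apply CV_radius_inside.
  - apply ex_pseries_incr_1. now apply ex_pseries_derive.
Qed.

Lemma euler_derive_frob (alpha x0 rho s : R) (u : nat -> R) :
  0 < alpha -> radius_ge (Rpower rho alpha) u ->
  euler_derive alpha x0 rho (frob alpha x0 s u) (frob alpha x0 s (euler_coef s u)).
Proof.
  intros Ha Hu x Hx.
  assert (Ht := Rpower_nonneg_lt alpha (x - x0) rho Ha ltac:(lra)).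
  assert (Hlt := radius_ge_lt _ _ _ Hu Ht).
  unfold frob. rewrite PSeries_euler_coef by trivial.
  set (t := Rpower (x - x0) alpha) in *.
  replace (alpha * (Rpower (x - x0) (s * alpha)
      * (s * PSeries u t + t * PSeries (PS_derive u) t)) / (x - x0))
    with (s * alpha * / (x - x0) * Rpower (x - x0) (s * alpha) * PSeries u t
      + Rpower (x - x0) (s * alpha)
        * (alpha * / (x - x0) * t * PSeries (PS_derive u) t)) by (field; lra).
  apply (is_derive_mult (fun x => Rpower (x - x0) (s * alpha))
    (fun x => PSeries u (Rpower (x - x0) alpha))).
  - apply is_derive_Rpower_shift. lra.
  - apply (is_derive_comp (PSeries u) (fun x => Rpower (x - x0) alpha)).
    + now apply is_derive_PSeries.
    + apply is_derive_Rpower_shift. lra.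
  - intros n m. apply Rmult_comm.
Qed.

Lemma frob_lin (alpha x0 rho s k : R) (u v : nat -> R) (x : R) :
  0 < alpha -> radius_ge (Rpower rho alpha) u -> radius_ge (Rpower rho alpha) v ->
  x0 < x < x0 + rho ->
  frob alpha x0 s (PS_plus u (PS_scal k v)) x
  = frob alpha x0 s u x + k * frob alpha x0 s v x.
Proof.
  intros Ha Hu Hv Hx.
  assert (Ht := Rpower_nonneg_lt alpha (x - x0) rho Ha ltac:(lra)).
  unfold frob. rewrite PSeries_plus, PSeries_scal.
  - ring.
  - apply CV_radius_inside. now apply radius_ge_lt with (1 := Hu).
  - apply CV_radius_inside. apply radius_ge_lt with (Rpower rho alpha); trivial.
    now apply radius_ge_scal.
Qed.

Lemma frob_mult (alpha x0 rho s : R) (u pc : nat -> R) (p : R -> R) (x : R) :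
  0 < alpha -> radius_ge (Rpower rho alpha) u -> radius_ge (Rpower rho alpha) pc ->
  frac_expansion alpha x0 rho 0 pc p -> x0 < x < x0 + rho ->
  frob alpha x0 s (PS_mult u pc) x = p x * frob alpha x0 s u x.
Proof.
  intros Ha Hu Hp Hpc Hx.
  assert (Ht := Rpower_nonneg_lt alpha (x - x0) rho Ha ltac:(lra)).
  unfold frob. rewrite PSeries_mult by now apply radius_ge_lt with (Rpower rho alpha).
  rewrite (frac_expansion_eq _ _ _ _ _ _ Hpc Hx). ring.
Qed.

Lemma frob_ext (alpha x0 s : R) (u v : nat -> R) (x : R) :
  (forall n, u n = v n) -> frob alpha x0 s u x = frob alpha x0 s v x.
Proof. intros E. unfold frob. now rewrite (PSeries_ext u v). Qed.

Lemma frob_incr_n (alpha x0 s : R) (N : nat) (u : nat -> R) (x : R) :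
  frob alpha x0 s (PS_incr_n u N) x = frob alpha x0 (s + INR N) u x.
Proof.
  unfold frob. rewrite PSeries_incr_n.
  rewrite (Rplus_comm s), Rpower_INR_mult. ring.
Qed.

Definition spike (d : R) (k : nat) : R := match k with O => d | S _ => 0 end.

Lemma radius_ge_spike (r d : R) : radius_ge r (spike d).
Proof.
  apply radius_ge_of_bound. intros t Ht. exists (Rabs d). intros [|n]; simpl.
  - rewrite Rmult_1_r. lra.
  - rewrite Rmult_0_l, Rabs_R0. apply Rabs_pos.
Qed.

Lemma PSeries_spike (d t : R) : 0 <= t -> PSeries (spike d) t = d.
Proof.
  intros Ht. rewrite PSeries_decr_1.
  - rewrite (PSeries_ext _ (fun _ => 0)) by reflexivity.
    rewrite PSeries_const_0. simpl. ring.
  - apply CV_radius_inside. apply radius_ge_lt with (t + 1).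
    + apply radius_ge_spike.
    + lra.
Qed.

Lemma frob_spike (alpha x0 s d : R) (x : R) :
  frob alpha x0 s (spike d) x = d * Rpower (x - x0) (s * alpha).
Proof.
  unfold frob. rewrite PSeries_spike by (left; apply exp_pos). ring.
Qed.

(** * The equation on fractional power series *)

Lemma ode_coef_frob (alpha x0 rho s : R) (p q : R -> R) (pc qc u : nat -> R) (x : R) :
  0 < alpha ->
  radius_ge (Rpower rho alpha) pc -> radius_ge (Rpower rho alpha) qc ->
  radius_ge (Rpower rho alpha) u ->
  frac_expansion alpha x0 rho 0 pc p -> frac_expansion alpha x0 rho 0 qc q ->
  x0 < x < x0 + rho ->
  alpha ^ 2 * (frob alpha x0 s (euler_coef s (euler_coef s u)) x
               - frob alpha x0 s (euler_coef s u) x)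
  + alpha * p x * frob alpha x0 s (euler_coef s u) x + q x * frob alpha x0 s u x
  = frob alpha x0 s (ode_coef alpha pc qc s u) x.
Proof.
  intros Ha Hp Hq Hu Hpc Hqc Hx.
  assert (Hu1 := radius_ge_euler _ s _ Hu).
  assert (Hu2 := radius_ge_euler _ s _ Hu1).
  set (u1 := euler_coef s u) in *. set (u2 := euler_coef s u1) in *.
  rewrite (frob_ext _ _ _ (ode_coef alpha pc qc s u)
    (PS_plus (PS_plus (PS_plus (PS_mult u qc) (PS_scal alpha (PS_mult u1 pc)))
      (PS_scal (alpha ^ 2) u2)) (PS_scal (- alpha ^ 2) u1))).
  2: { intros n. unfold ode_coef, PS_plus, PS_scal, plus, scal; simpl; unfold mult; simpl.
       fold u1 u2. ring. }
  assert (H1 := radius_ge_mult _ _ _ Hu Hq).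
  assert (H2 := radius_ge_mult _ _ _ Hu1 Hp).
  assert (H3 := radius_ge_plus _ _ _ H1 (radius_ge_scal _ alpha _ H2)).
  assert (H4 := radius_ge_plus _ _ _ H3 (radius_ge_scal _ (alpha ^ 2) _ Hu2)).
  rewrite !(frob_lin alpha x0 rho), (frob_mult alpha x0 rho s u qc q),
    (frob_mult alpha x0 rho s u1 pc p) by trivial.
  ring.
Qed.

Lemma euler_equation_frob (alpha x0 rho s : R) (p q : R -> R) (pc qc u : nat -> R) :
  0 < alpha ->
  radius_ge (Rpower rho alpha) pc -> radius_ge (Rpower rho alpha) qc ->
  radius_ge (Rpower rho alpha) u ->
  frac_expansion alpha x0 rho 0 pc p -> frac_expansion alpha x0 rho 0 qc q ->
  euler_equation alpha x0 rho p q (frob alpha x0 s u)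
    (frob alpha x0 s (ode_coef alpha pc qc s u)).
Proof.
  intros Ha Hp Hq Hu Hpc Hqc.
  assert (Hu1 := radius_ge_euler _ s _ Hu).
  exists (frob alpha x0 s (euler_coef s u)),
    (frob alpha x0 s (euler_coef s (euler_coef s u))).
  split; [|split]; [now apply euler_derive_frob..|].
  intros x Hx. now apply ode_coef_frob with rho.
Qed.

(** Coefficients of what remains when the equation is applied to [ln] times a
    solution: the terms in which one Euler derivative fell on the logarithm. *)
Definition log_defect (alpha : R) (pc : nat -> R) (s : R) (u : nat -> R) : nat -> R :=
  PS_plus (PS_mult u pc)
    (PS_plus (PS_scal (2 * alpha) (euler_coef s u)) (PS_scal (- alpha) u)).

(** With [theta] the Euler operator and [l = ln (x - x0)], [theta l = 1 / alpha], hence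
    [theta (theta (l * f)) = l * theta (theta f) + (2 / alpha) * theta f]. As [f] is a
    solution, the terms that keep the logarithm cancel. *)
Lemma euler_equation_ln_frob (alpha x0 rho s : R) (p q : R -> R) (pc qc u : nat -> R) :
  0 < alpha ->
  radius_ge (Rpower rho alpha) pc -> radius_ge (Rpower rho alpha) qc ->
  radius_ge (Rpower rho alpha) u ->
  frac_expansion alpha x0 rho 0 pc p -> frac_expansion alpha x0 rho 0 qc q ->
  (forall k, ode_coef alpha pc qc s u k = 0) ->
  euler_equation alpha x0 rho p q (fun x => ln (x - x0) * frob alpha x0 s u x)
    (frob alpha x0 s (log_defect alpha pc s u)).
Proof.
  intros Ha Hp Hq Hu Hpc Hqc H0.
  assert (Hu1 := radius_ge_euler _ s _ Hu).
  assert (Hu2 := radius_ge_euler _ s _ Hu1).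
  assert (E1 := euler_derive_frob alpha x0 rho s u Ha Hu).
  assert (E2 := euler_derive_frob alpha x0 rho s _ Ha Hu1).
  eexists. eexists. split; [|split].
  - exact (euler_derive_ln_mult _ _ _ _ _ Ha E1).
  - apply euler_derive_plus.
    + exact (euler_derive_scal _ _ _ (/ alpha) _ _ E1).
    + exact (euler_derive_ln_mult _ _ _ _ _ Ha E2).
  - intros x Hx. cbv beta.
    assert (H := ode_coef_frob alpha x0 rho s p q pc qc u x Ha Hp Hq Hu Hpc Hqc Hx).
    rewrite (frob_ext _ _ _ (ode_coef alpha pc qc s u) (spike 0)), frob_spike in H
      by (intros [|n]; apply H0).
    assert (Hup := radius_ge_mult _ _ _ Hu Hp).
    rewrite (frob_ext _ _ _ (log_defect alpha pc s u)
      (PS_plus (PS_plus (PS_mult u pc) (PS_scal (2 * alpha) (euler_coef s u)))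
        (PS_scal (- alpha) u)))
      by (intros n; unfold log_defect, PS_plus; apply plus_assoc).
    rewrite !(frob_lin alpha x0 rho), (frob_mult alpha x0 rho s u pc p) by
      (trivial; apply radius_ge_plus; trivial; now apply radius_ge_scal).
    set (f := frob alpha x0 s u x) in *.
    set (f1 := frob alpha x0 s (euler_coef s u) x) in *.
    set (f2 := frob alpha x0 s (euler_coef s (euler_coef s u)) x) in *.
    transitivity (ln (x - x0) * (alpha ^ 2 * (f2 - f1) + alpha * p x * f1 + q x * f)
      + (p x * f + 2 * alpha * f1 + - alpha * f)); [field; lra|].
    rewrite H. ring.
Qed.

Lemma log_defect_0 (alpha s1 s2 : R) (pc qc u : nat -> R) :
  0 < alpha ->
  quadratic_roots (alpha ^ 2) (indicial alpha (pc 0%nat) (qc 0%nat)) s1 s2 ->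
  log_defect alpha pc s1 u 0 = alpha * (s1 - s2) * u 0%nat.
Proof.
  intros Ha Hroots.
  assert (H1 := Hroots 1). assert (H0 := Hroots 0). assert (H2 := Hroots (-1)).
  unfold indicial in *.
  assert (Hp : pc 0%nat = alpha * (1 - s1 - s2)).
  { apply Rmult_eq_reg_l with alpha; [|lra]. lra. }
  unfold log_defect, euler_coef, PS_mult, PS_plus, PS_scal, plus, scal; simpl; unfold mult; simpl.
  rewrite Hp. ring.
Qed.

Lemma radius_ge_log_defect (alpha r s : R) (pc u : nat -> R) :
  radius_ge r pc -> radius_ge r u -> radius_ge r (log_defect alpha pc s u).
Proof.
  intros Hp Hu. unfold log_defect.
  apply radius_ge_plus; [now apply radius_ge_mult|].
  apply radius_ge_plus; apply radius_ge_scal; trivial. now apply radius_ge_euler.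
Qed.

(** * Linear independence *)

Lemma is_lim_seq_exp_opp : is_lim_seq (fun n => exp (- INR n)) 0.
Proof.
  apply is_lim_seq_le_le with (fun _ => 0) (fun n => / (INR n + 1)).
  - intros n. split; [left; apply exp_pos|].
    rewrite exp_Ropp. apply Rinv_le_contravar.
    + assert (h := pos_INR n). lra.
    + rewrite Rplus_comm. apply exp_ineq1_le.
  - apply is_lim_seq_const.
  - apply is_lim_seq_ext with (fun n => / INR (S n)).
    + intros n. now rewrite S_INR.
    + apply (is_lim_seq_incr_1 (fun n => / INR n)).
      apply is_lim_seq_inv with (l := p_infty); [apply is_lim_seq_INR|easy].
Qed.

Lemma is_lim_seq_INR_exp_opp : is_lim_seq (fun n => INR n * exp (- INR n)) 0.
Proof.
  (* [exp n = exp (n / 2) ^ 2 >= (1 + n / 2) ^ 2], which bounds the term by [4 / (n + 1)] *)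
  apply is_lim_seq_le_le with (fun _ => 0) (fun n => 4 * / INR (S n)).
  - intros n. assert (h := pos_INR n). split.
    { apply Rmult_le_pos; [lra|left; apply exp_pos]. }
    rewrite exp_Ropp.
    assert (He : (1 + INR n / 2) * (1 + INR n / 2) <= exp (INR n)).
    { replace (INR n) with (INR n / 2 + INR n / 2) at 3 by field. rewrite exp_plus.
      assert (h1 := exp_ineq1_le (INR n / 2)). nra. }
    assert (0 < exp (INR n)) by apply exp_pos.
    rewrite S_INR.
    apply Rle_div_l; [lra|].
    replace (4 * / (INR n + 1) * exp (INR n)) with (4 * exp (INR n) / (INR n + 1))
      by (field; lra).
    apply Rle_div_r; [lra|]. nra.
  - apply is_lim_seq_const.
  - replace (Finite 0) with (Rbar_mult 4 0) by (simpl; f_equal; ring).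
    apply is_lim_seq_scal_l.
    apply (is_lim_seq_incr_1 (fun n => / INR n)).
    apply is_lim_seq_inv with (l := p_infty); [apply is_lim_seq_INR|easy].
Qed.

Lemma exp_opp_eventually_lt (r : R) :
  0 < r -> eventually (fun n => exp (- INR n) < r).
Proof.
  intros Hr. assert (H := is_lim_seq_exp_opp). apply is_lim_seq_spec in H.
  generalize (H (mkposreal r Hr)). apply filter_imp.
  intros n Hn. simpl in Hn. apply Rabs_lt_between in Hn. lra.
Qed.

Lemma is_lim_seq_PSeries_exp_opp (r : R) (u : nat -> R) :
  0 < r -> radius_ge r u -> is_lim_seq (fun n => PSeries u (exp (- INR n))) (u 0%nat).
Proof.
  intros Hr Hu. rewrite <- PSeries_0.
  apply is_lim_seq_continuous; [|apply is_lim_seq_exp_opp].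
  apply PSeries_continuity. apply radius_ge_lt with r; trivial. lra.
Qed.

Lemma is_lim_seq_eventually_0 (v : nat -> R) (l : R) :
  eventually (fun n => v n = 0) -> is_lim_seq v l -> l = 0.
Proof.
  intros H0 Hv.
  assert (H : is_lim_seq v 0).
  { apply is_lim_seq_ext_loc with (fun _ => 0); [|apply is_lim_seq_const].
    generalize H0. apply filter_imp. intros n Hn. now symmetry. }
  apply is_lim_seq_unique in Hv. apply is_lim_seq_unique in H. congruence.
Qed.

Lemma frob_at_power (alpha x0 s t : R) (u : nat -> R) :
  0 < alpha -> 0 < t ->
  frob alpha x0 s u (x0 + Rpower t (/ alpha)) = Rpower t s * PSeries u t.
Proof.
  intros Ha Ht. unfold frob.
  replace (x0 + Rpower t (/ alpha) - x0) with (Rpower t (/ alpha)) by ring.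
  rewrite !Rpower_mult.
  replace (/ alpha * (s * alpha)) with s by (field; lra).
  rewrite Rinv_l, Rpower_1; lra.
Qed.

(** Along [t = exp (- n)] a vanishing combination reads
    [A t^N U + B (- C n t^N U / alpha + W) = 0]. If [N > 0] everything tends to [0] but
    [B W], whose limit is [B b 0]; if [N = 0] and [C <> 0] the logarithm dominates,
    so division by [n] leaves [B C c 0]. Either way [B = 0], and then [A c 0 = 0]. *)
Lemma lin_indep_log (alpha x0 rho s C : R) (N : nat) (c b : nat -> R) :
  0 < alpha -> 0 < rho ->
  radius_ge (Rpower rho alpha) c -> radius_ge (Rpower rho alpha) b ->
  c 0%nat <> 0 ->
  (N = 0%nat /\ C <> 0 \/ (0 < N)%nat /\ b 0%nat <> 0) ->
  lin_indep_on x0 (x0 + rho) (frob alpha x0 (s + INR N) c)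
    (fun x => C * ln (x - x0) * frob alpha x0 (s + INR N) c x + frob alpha x0 s b x).
Proof.
  intros Ha Hrho Hc Hb Hc0 Hcase A B H.
  assert (HR : 0 < Rpower rho alpha) by apply exp_pos.
  set (r := Rpower rho alpha) in *.
  assert (Ht : forall t, 0 < t < r ->
    A * (t ^ N * PSeries c t)
    + B * (C / alpha * ln t * (t ^ N * PSeries c t) + PSeries b t) = 0).
  { intros t Ht.
    assert (Hx : x0 < x0 + Rpower t (/ alpha) < x0 + rho).
    { assert (0 < Rpower t (/ alpha)) by apply exp_pos.
      assert (Rpower t (/ alpha) < Rpower r (/ alpha)).
      { apply Rlt_Rpower_l; [now apply Rinv_0_lt_compat|lra]. }
      unfold r in *. rewrite Rpower_mult, Rinv_r, Rpower_1 in * by lra. lra. }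
    assert (Hx' := H _ Hx). rewrite !frob_at_power in Hx' by lra.
    replace (x0 + Rpower t (/ alpha) - x0) with (Rpower t (/ alpha)) in Hx' by ring.
    rewrite ln_Rpower, Rpower_plus, Rpower_pow in Hx' by lra.
    apply Rmult_eq_reg_l with (Rpower t s); [|apply Rgt_not_eq, exp_pos].
    rewrite Rmult_0_r. rewrite <- Hx'. field. lra. }
  assert (Hn : eventually (fun n =>
    A * (exp (- INR n) ^ N * PSeries c (exp (- INR n)))
    + B * (C / alpha * - INR n * (exp (- INR n) ^ N * PSeries c (exp (- INR n)))
           + PSeries b (exp (- INR n))) = 0)).
  { generalize (exp_opp_eventually_lt r HR). apply filter_imp.
    intros n Hn. assert (h := exp_pos (- INR n)).
    specialize (Ht _ (conj h Hn)). now rewrite ln_exp in Ht. }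
  assert (Uc := is_lim_seq_PSeries_exp_opp r c HR Hc).
  assert (Ub := is_lim_seq_PSeries_exp_opp r b HR Hb).
  assert (HB : B = 0).
  { destruct Hcase as [[-> HC]|[HN Hb0]].
    - assert (Hinv : is_lim_seq (fun n => / INR n) 0).
      { apply is_lim_seq_inv with (l := p_infty); [apply is_lim_seq_INR|easy]. }
      assert (L := is_lim_seq_mult' _ _ _ _
        (is_lim_seq_plus' _ _ _ _
          (is_lim_seq_mult' _ _ _ _ (is_lim_seq_const A) Uc)
          (is_lim_seq_mult' _ _ _ _ (is_lim_seq_const B) Ub)) Hinv).
      assert (L' := is_lim_seq_plus' _ _ _ _ L
        (is_lim_seq_mult' _ _ _ _ (is_lim_seq_const (- (B * C / alpha))) Uc)).
      apply is_lim_seq_eventually_0 in L'.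
      + assert (E : B * (C * c 0%nat * / alpha) = 0) by lra.
        apply Rmult_integral in E as [E|E]; trivial.
        exfalso. revert E. repeat apply Rmult_integral_contrapositive_currified; trivial.
        apply Rinv_neq_0_compat. lra.
      + destruct Hn as [n0 Hn0]. exists (S n0). intros n Hle.
        specialize (Hn0 n ltac:(lia)).
        assert (Hpos : 0 < INR n) by (apply lt_0_INR; lia).
        set (U := PSeries c (exp (- INR n))) in *. set (W := PSeries b (exp (- INR n))) in *.
        simpl pow in Hn0.
        apply Rmult_eq_reg_l with (INR n); [|lra].
        rewrite Rmult_0_r. rewrite <- Hn0. field. lra.
    - destruct N as [|M]; [lia|].
      set (V := fun t => t ^ M * PSeries c t).
      assert (LV : is_lim_seq (fun n => V (exp (- INR n))) (V 0)).
      { apply is_lim_seq_continuous; [|apply is_lim_seq_exp_opp].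
        unfold V. apply continuity_pt_mult.
        - apply derivable_continuous_pt, derivable_pt_pow.
        - apply PSeries_continuity. apply radius_ge_lt with r; trivial. lra. }
      assert (L1 := is_lim_seq_mult' _ _ _ _ is_lim_seq_exp_opp LV).
      assert (L2 := is_lim_seq_mult' _ _ _ _ is_lim_seq_INR_exp_opp LV).
      assert (L := is_lim_seq_plus' _ _ _ _
        (is_lim_seq_mult' _ _ _ _ (is_lim_seq_const A) L1)
        (is_lim_seq_plus' _ _ _ _
          (is_lim_seq_mult' _ _ _ _ (is_lim_seq_const (- (B * C / alpha))) L2)
          (is_lim_seq_mult' _ _ _ _ (is_lim_seq_const B) Ub))).
      apply is_lim_seq_eventually_0 in L.
      + assert (E : B * b 0%nat = 0) by lra.
        apply Rmult_integral in E as [E|E]; [trivial|contradiction].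
      + generalize Hn. apply filter_imp. intros n E.
        rewrite <- E. unfold V. simpl pow. field. lra. }
  split; trivial. subst B.
  assert (L := is_lim_seq_mult' _ _ _ _ (is_lim_seq_const A) Uc).
  apply is_lim_seq_eventually_0 in L.
  - apply Rmult_integral in L as [L|L]; [trivial|contradiction].
  - generalize Hn. apply filter_imp. intros n E.
    assert (h : 0 < exp (- INR n) ^ N) by apply pow_lt, exp_pos.
    apply Rmult_eq_reg_l with (exp (- INR n) ^ N); [|lra].
    rewrite Rmult_0_r. rewrite <- E. ring.
Qed.

Lemma lin_indep_on_ext (a b : R) (f g g' : R -> R) :
  (forall x, a < x < b -> g x = g' x) ->
  lin_indep_on a b f g -> lin_indep_on a b f g'.
Proof.
  intros E H A B HAB. apply H. intros x Hx. rewrite E by trivial. auto.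
Qed.

(** * Frobenius solutions *)

Lemma indicial_neq_0 (alpha s1 s2 : R) (pc qc : nat -> R) (s : R) :
  0 < alpha ->
  quadratic_roots (alpha ^ 2) (indicial alpha (pc 0%nat) (qc 0%nat)) s1 s2 ->
  s <> s1 -> s <> s2 -> indicial alpha (pc 0%nat) (qc 0%nat) s <> 0.
Proof.
  intros Ha H H1 H2. rewrite H.
  repeat apply Rmult_integral_contrapositive_currified; lra.
Qed.

Lemma indicial_roots (alpha s1 s2 : R) (pc qc : nat -> R) :
  quadratic_roots (alpha ^ 2) (indicial alpha (pc 0%nat) (qc 0%nat)) s1 s2 ->
  indicial alpha (pc 0%nat) (qc 0%nat) s1 = 0 /\
  indicial alpha (pc 0%nat) (qc 0%nat) s2 = 0.
Proof. intros H. rewrite !H. split; ring. Qed.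

Lemma frobenius_larger_root (alpha rad s1 s2 : R) (N : nat) (pc qc g : nat -> R) (u0 : R) :
  0 < alpha -> radius_ge rad pc -> radius_ge rad qc -> radius_ge rad g ->
  quadratic_roots (alpha ^ 2) (indicial alpha (pc 0%nat) (qc 0%nat)) s1 s2 ->
  s1 = s2 + INR N ->
  exists u, u 0%nat = u0 /\ radius_ge rad u /\
    ode_coef alpha pc qc s1 u 0 = 0 /\
    forall m, ode_coef alpha pc qc s1 u (S m) = g (S m).
Proof.
  intros Ha Hp Hq Hg Hroots HN.
  destruct (ode_coef_solvable alpha pc qc s1 u0 g) as [u [H0 Hu]].
  assert (Hu' : forall m, ode_coef alpha pc qc s1 u (S m) = g (S m)).
  { intros m. apply Hu. assert (h := pos_INR N). assert (h' := pos_INR m).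
    apply indicial_neq_0 with s1 s2; trivial; rewrite S_INR; lra. }
  exists u. split; [|split; [|split]]; trivial.
  - apply ode_coef_radius with alpha s1 pc qc g 1%nat; trivial.
    intros [|k] Hk; [lia|apply Hu'].
  - rewrite ode_coef_0, (proj1 (indicial_roots _ _ _ _ _ Hroots)). ring.
Qed.

(** At the smaller root the recursion breaks down only at index [N], where the
    larger root is met; setting the residual [d] there aside, the series solves the
    equation up to [d * (x - x0) ^ (s1 * alpha)]. *)
Lemma frobenius_smaller_root (alpha x0 rho s1 s2 : R) (N : nat) (p q : R -> R)
    (pc qc : nat -> R) :
  0 < alpha ->
  radius_ge (Rpower rho alpha) pc -> radius_ge (Rpower rho alpha) qc ->
  frac_expansion alpha x0 rho 0 pc p -> frac_expansion alpha x0 rho 0 qc q ->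
  quadratic_roots (alpha ^ 2) (indicial alpha (pc 0%nat) (qc 0%nat)) s1 s2 ->
  (0 < N)%nat -> s1 = s2 + INR N ->
  exists (u : nat -> R) (d : R), u 0%nat = 1 /\ radius_ge (Rpower rho alpha) u /\
    euler_equation alpha x0 rho p q (frob alpha x0 s2 u)
      (fun x => d * Rpower (x - x0) (s1 * alpha)).
Proof.
  intros Ha Hp Hq Hpc Hqc Hroots HN0 HN.
  destruct (ode_coef_solvable alpha pc qc s2 1 (fun _ => 0)) as [u [H0 Hu]].
  assert (Hu' : forall k, k <> N -> ode_coef alpha pc qc s2 u k = 0).
  { intros [|m] Hm.
    - rewrite ode_coef_0, (proj2 (indicial_roots _ _ _ _ _ Hroots)). ring.
    - apply Hu. apply indicial_neq_0 with s1 s2; trivial.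
      + rewrite HN. intros E. apply Hm, INR_eq. lra.
      + assert (h := pos_INR m). rewrite S_INR. lra. }
  assert (Hr : radius_ge (Rpower rho alpha) u).
  { apply ode_coef_radius with alpha s2 pc qc (fun _ => 0) (S N); trivial.
    - apply radius_ge_zero.
    - intros k Hk. apply Hu'. lia. }
  exists u, (ode_coef alpha pc qc s2 u N). split; [|split]; trivial.
  generalize (euler_equation_frob alpha x0 rho s2 p q pc qc u Ha Hp Hq Hr Hpc Hqc).
  apply euler_equation_ext_rhs. intros x Hx.
  rewrite <- frob_spike, HN, <- frob_incr_n.
  apply frob_ext. intros k. rewrite PS_incr_n_simplify.
  destruct (le_lt_dec N k) as [Hk|Hk].
  - destruct (Nat.eq_dec k N) as [->|Hne].
    + now rewrite Nat.sub_diag.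
    + rewrite Hu' by trivial. destruct (k - N)%nat eqn:E; [lia|reflexivity].
  - apply Hu'. lia.
Qed.

(** The defect of [ln * y1] is a series with exponent [s1], which a series [w] cancels
    from its second term on. The first term [alpha * (s1 - s2) * c 0] is out of reach
    since [s1] is a root; for [c 0 <> 0] it vanishes exactly when the root is double. *)
Lemma frobenius_log (alpha x0 rho s1 s2 : R) (N : nat) (p q : R -> R)
    (pc qc c : nat -> R) :
  0 < alpha ->
  radius_ge (Rpower rho alpha) pc -> radius_ge (Rpower rho alpha) qc ->
  radius_ge (Rpower rho alpha) c ->
  frac_expansion alpha x0 rho 0 pc p -> frac_expansion alpha x0 rho 0 qc q ->
  quadratic_roots (alpha ^ 2) (indicial alpha (pc 0%nat) (qc 0%nat)) s1 s2 ->
  s1 = s2 + INR N ->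
  (forall k, ode_coef alpha pc qc s1 c k = 0) ->
  exists w : nat -> R, w 0%nat = 0 /\ radius_ge (Rpower rho alpha) w /\
    euler_equation alpha x0 rho p q
      (fun x => ln (x - x0) * frob alpha x0 s1 c x + -1 * frob alpha x0 s1 w x)
      (fun x => alpha * (s1 - s2) * c 0%nat * Rpower (x - x0) (s1 * alpha)).
Proof.
  intros Ha Hp Hq Hc Hpc Hqc Hroots HN H0.
  set (h := log_defect alpha pc s1 c).
  assert (Hh : radius_ge (Rpower rho alpha) h) by now apply radius_ge_log_defect.
  destruct (frobenius_larger_root alpha (Rpower rho alpha) s1 s2 N pc qc h 0)
    as (w & Hw0 & Hw & Hode0 & Hode); trivial.
  exists w. split; [|split]; trivial.
  assert (E1 := euler_equation_ln_frob alpha x0 rho s1 p q pc qc c Ha Hp Hq Hc Hpc Hqc H0).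
  assert (E2 := euler_equation_frob alpha x0 rho s1 p q pc qc w Ha Hp Hq Hw Hpc Hqc).
  generalize (euler_equation_lin _ _ _ (-1) _ _ _ _ _ _ E1 E2).
  apply euler_equation_ext_rhs. intros x Hx. fold h.
  assert (Hr : radius_ge (Rpower rho alpha) (ode_coef alpha pc qc s1 w)).
  { apply radius_ge_ext with (PS_plus h (PS_scal (-1) (spike (h 0%nat)))).
    - intros [|m].
      + rewrite Hode0. change (h 0%nat + -1 * h 0%nat = 0). ring.
      + rewrite Hode. change (h (S m) + -1 * 0 = h (S m)). ring.
    - apply radius_ge_plus; trivial. apply radius_ge_scal, radius_ge_spike. }
  rewrite <- (frob_lin alpha x0 rho s1 (-1)) by trivial.
  rewrite <- (log_defect_0 alpha s1 s2 pc qc c Ha Hroots). fold h.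
  rewrite <- frob_spike. apply frob_ext. intros [|m].
  - change (h 0%nat + -1 * ode_coef alpha pc qc s1 w 0 = h 0%nat). rewrite Hode0. ring.
  - change (h (S m) + -1 * ode_coef alpha pc qc s1 w (S m) = 0). rewrite Hode. ring.
Qed.

Theorem theorem3p2 :
  forall (alpha x0 rho : R) (p q : R -> R) (pc qc : nat -> R) (s1 s2 : R),
    0 < alpha <= 1 ->
    0 < rho ->
    regular_alpha_singular alpha x0
      (fun x => p x / Rpower (x - x0) alpha)
      (fun x => q x / Rpower (x - x0) (2 * alpha)) ->
    frac_expansion alpha x0 rho 0 pc p ->
    frac_expansion alpha x0 rho 0 qc q ->
    quadratic_roots (alpha ^ 2) (indicial alpha (pc 0%nat) (qc 0%nat)) s1 s2 ->
    (s1 = s2 ->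
      exists (y1 y2 phi : R -> R) (c b : nat -> R),
        is_solution alpha x0 rho p q y1 /\
        is_solution alpha x0 rho p q y2 /\
        lin_indep_on x0 (x0 + rho) y1 y2 /\
        c 0%nat <> 0 /\
        frac_expansion alpha x0 rho s1 c y1 /\
        frac_expansion alpha x0 rho (s1 + 1) b phi /\
        (forall x : R, x0 < x < x0 + rho ->
           y2 x = ln (Rabs (x - x0)) * y1 x + phi x))
    /\
    ((exists N : nat, (0 < N)%nat /\ s1 - s2 = INR N) ->
      exists (y1 y2 phi : R -> R) (c b : nat -> R) (C : R),
        is_solution alpha x0 rho p q y1 /\
        is_solution alpha x0 rho p q y2 /\
        lin_indep_on x0 (x0 + rho) y1 y2 /\
        c 0%nat <> 0 /\
        frac_expansion alpha x0 rho s1 c y1 /\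
        frac_expansion alpha x0 rho s2 b phi /\
        (forall x : R, x0 < x < x0 + rho ->
           y2 x = C * ln (Rabs (x - x0)) * y1 x + phi x)).
Proof.
  intros alpha x0 rho p q pc qc s1 s2 [Ha _] Hrho _ Hpc Hqc Hroots.
  assert (Hp := frac_expansion_radius _ _ _ _ _ Ha Hrho Hpc).
  assert (Hq := frac_expansion_radius _ _ _ _ _ Ha Hrho Hqc).
  assert (first : forall N, s1 = s2 + INR N ->
    exists c, c 0%nat = 1 /\ radius_ge (Rpower rho alpha) c /\
      (forall k, ode_coef alpha pc qc s1 c k = 0) /\
      is_solution alpha x0 rho p q (frob alpha x0 s1 c)).
  { intros N HN.
    destruct (frobenius_larger_root alpha (Rpower rho alpha) s1 s2 N pc qc (fun _ => 0) 1)
      as (c & Hc0 & Hc & H0 & HS); trivial; [apply radius_ge_zero|].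
    assert (Hode : forall k, ode_coef alpha pc qc s1 c k = 0) by (intros [|k]; auto).
    exists c. split; [|split; [|split]]; trivial.
    apply euler_equation_is_solution.
    generalize (euler_equation_frob alpha x0 rho s1 p q pc qc c Ha Hp Hq Hc Hpc Hqc).
    apply euler_equation_ext_rhs. intros x _.
    rewrite (frob_ext _ _ _ _ (spike 0)) by (intros [|k]; apply Hode).
    rewrite frob_spike. ring. }
  split.
  - intros Heq.
    assert (HN : s1 = s2 + INR 0) by (simpl; lra).
    destruct (first 0%nat HN) as (c & Hc0 & Hc & Hode & Hsol).
    destruct (frobenius_log alpha x0 rho s1 s2 0 p q pc qc c) as (w & Hw0 & Hw & Hlog); trivial.
    assert (Hshift : forall x, frob alpha x0 s1 w x = frob alpha x0 (s1 + 1) (PS_decr_1 w) x).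
    { intros x. change 1 with (INR 1). rewrite <- frob_incr_n. apply frob_ext.
      intros [|k]; [exact Hw0|reflexivity]. }
    assert (Hw' : radius_ge (Rpower rho alpha) (PS_decr_1 w)).
    { unfold radius_ge. now rewrite CV_radius_decr_1. }
    exists (frob alpha x0 s1 c),
      (fun x => ln (x - x0) * frob alpha x0 s1 c x + -1 * frob alpha x0 s1 w x),
      (frob alpha x0 (s1 + 1) (PS_scal (-1) (PS_decr_1 w))),
      c, (PS_scal (-1) (PS_decr_1 w)).
    split; [trivial|]. split; [|split; [|split; [|split; [|split]]]].
    + apply euler_equation_is_solution. revert Hlog.
      apply euler_equation_ext_rhs. intros x _. rewrite Heq. ring.
    + replace s1 with (s1 + INR 0) by (simpl; ring).
      apply lin_indep_on_ext with (fun x => 1 * ln (x - x0) * frob alpha x0 (s1 + INR 0) c x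
        + frob alpha x0 s1 (PS_scal (-1) w) x).
      * intros x _. unfold frob at 2 4. rewrite PSeries_scal.
        replace (s1 + INR 0) with s1 by (simpl; ring). ring.
      * apply lin_indep_log; trivial.
        -- now apply radius_ge_scal.
        -- rewrite Hc0. lra.
        -- left. split; [trivial|lra].
    + rewrite Hc0. lra.
    + now apply frob_expansion.
    + apply frob_expansion; trivial. now apply radius_ge_scal.
    + intros x Hx. rewrite Rabs_pos_eq, Hshift by lra.
      unfold frob. rewrite PSeries_scal. ring.
  - intros (N & HN0 & HN').
    assert (HN : s1 = s2 + INR N) by lra.
    destruct (first N HN) as (c & Hc0 & Hc & Hode & Hsol).
    destruct (frobenius_log alpha x0 rho s1 s2 N p q pc qc c) as (w & Hw0 & Hw & Hlog); trivial.
    destruct (frobenius_smaller_root alpha x0 rho s1 s2 N p q pc qc)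
      as (u & d & Hu0 & Hu & Heu); trivial.
    assert (HNpos : 0 < INR N) by (apply lt_0_INR; lia).
    (* this multiple of the logarithmic term cancels the residual [d] *)
    set (C := - d / (alpha * (s1 - s2) * c 0%nat)).
    set (b := PS_plus u (PS_scal (- C) (PS_incr_n w N))).
    assert (Hwn : radius_ge (Rpower rho alpha) (PS_incr_n w N)) by now apply radius_ge_incr_n.
    assert (Hb : radius_ge (Rpower rho alpha) b).
    { apply radius_ge_plus; trivial. now apply radius_ge_scal. }
    assert (Hphi : forall x, x0 < x < x0 + rho ->
      frob alpha x0 s2 b x = frob alpha x0 s2 u x + - C * frob alpha x0 s1 w x).
    { intros x Hx. unfold b. rewrite (frob_lin alpha x0 rho), frob_incr_n, <- HN; trivial. }
    exists (frob alpha x0 s1 c),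
      (fun x => frob alpha x0 s2 u x
        + C * (ln (x - x0) * frob alpha x0 s1 c x + -1 * frob alpha x0 s1 w x)),
      (frob alpha x0 s2 b), c, b, C.
    split; [trivial|]. split; [|split; [|split; [|split; [|split]]]].
    + apply euler_equation_is_solution.
      generalize (euler_equation_lin _ _ _ C _ _ _ _ _ _ Heu Hlog).
      apply euler_equation_ext_rhs. intros x _. unfold C. rewrite Hc0. field.
      split; lra.
    + apply lin_indep_on_ext with (fun x => C * ln (x - x0) * frob alpha x0 s1 c x
        + frob alpha x0 s2 b x).
      * intros x Hx. rewrite Hphi by trivial. ring.
      * rewrite HN. apply lin_indep_log; trivial.
        -- rewrite Hc0. lra.
        -- right. split; [trivial|].
           change (u 0%nat + - C * PS_incr_n w N 0 <> 0).
           rewrite PS_incr_n_simplify, Hu0.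
           destruct (le_lt_dec N 0) as [Hle|_]; [lia|].
           change (1 + - C * 0 <> 0). lra.
    + rewrite Hc0. lra.
    + now apply frob_expansion.
    + now apply frob_expansion.
    + intros x Hx. rewrite Rabs_pos_eq, Hphi by (trivial; lra). ring.
Qed.
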